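(* Let $P_1$ and $P_2$ be the base polytopes of two gammoids $M_1$ and $M_2$ of rank $k$ defined on the same (finite) ground set $S$. Let $P:=P_1\cap P_2$. Then $P$ has the Integer Carathéodory Property.
   Context: Given a finite digraph $D=(V,A)$ and subsets $U,S\subseteq V$, one defines a matroid on $S$ as follows: a subset $I\subseteq S$ is independent if there exists $I'\subseteq U$ with $|I'|=|I|$ and there are $|I|$ vertex-disjoint directed paths from $I'$ to $I$ in $D$ (paths of length zero, consisting of a single vertex, are allowed). A gammoid is a matroid isomorphic to a matroid defined in this way. The base polytope of a matroid on $S$ is the convex hull in $\mathbb{R}^S$ of the incidence vectors of its bases. For a set $P\subseteq\mathbb{R}^S$ and a positive integer $q$, $qP=\{qx:x\in P\}$. A polyhedron $P\subseteq\mathbb{R}^S$ has the Integer Carathéodory Property (ICP) if for every positive integer $q$ and every integer vector $w\in qP$ there exist affinely independent $x_1,\ldots,x_t\in P\cap\mathbb{Z}^S$ and $n_1,\ldots,n_t\in\mathbb{Z}_{\ge 0}$ such that $n_1+\cdots+n_t=q$ and $w=\sum_{i} n_i x_i$. *)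

(* Defs.v *)
From HB Require Import structures.
From mathcomp Require Import all_boot all_order all_algebra.
From mathcomp Require Import classical_sets reals.

Set Implicit Arguments.
Unset Strict Implicit.
Unset Printing Implicit Defensive.

Import Order.TTheory GRing.Theory Num.Theory.
Local Open Scope ring_scope.

Record matroid (S : finType) := Matroid {
  indep : {set {set S}};
  indep_set0 : finset.set0 \in indep;
  indep_sub : forall I J : {set S},
    J \subset I -> I \in indep -> J \in indep;
  indep_augment : forall I J : {set S},
    I \in indep -> J \in indep -> (#|I| < #|J|)%N ->
    exists2 e, e \in J :\: I & (e |: I)%SET \in indep }.

Definition is_base (S : finType) (M : matroid S) (B : {set S}) : bool :=
  maxset (fun I : {set S} => I \in indep M) B.

Definition rank (S : finType) (M : matroid S) : nat :=
  (\max_(I in indep M) #|I|)%N.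

Section Gammoids.
Variable V : finType.

(* The pair (v, s) stands for the vertex sequence v :: s; s is empty for a
   path of length zero. *)
Definition is_dipath (A : rel V) (p : V * seq V) : bool :=
  path A p.1 p.2 && uniq (p.1 :: p.2).

Definition path_start (p : V * seq V) : V := p.1.
Definition path_end (p : V * seq V) : V := last p.1 p.2.
Definition path_vertices (p : V * seq V) : {set V} :=
  [set v | v \in p.1 :: p.2]%SET.

(* Since the paths are pairwise vertex-disjoint, their starting points
   exhaust I' and their endpoints exhaust I. *)
Definition linked_onto (A : rel V) (U I : {set V}) : Prop :=
  exists I' : {set V}, [/\ I' \subset U, #|I'| = #|I| &
    exists p : 'I_#|I| -> V * seq V,
      [/\ forall i, is_dipath A (p i),
          forall i, path_start (p i) \in I',
          forall i, path_end (p i) \in I &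
          forall i j, i != j ->
            [disjoint path_vertices (p i) & path_vertices (p j)]]].

Definition gammoid_indep (A : rel V) (U S0 I : {set V}) : Prop :=
  I \subset S0 /\ linked_onto A U I.

End Gammoids.

(* f is an isomorphism from M onto the matroid on the vertex subset S0 defined
   by the digraph (V, A) and the set U of sources. *)
Definition is_gammoid (S : finType) (M : matroid S) : Prop :=
  exists (V : finType) (A : rel V) (U S0 : {set V}) (f : S -> V),
    [/\ injective f, (f @: [set: S])%SET = S0 &
        forall I : {set S},
          I \in indep M <-> gammoid_indep A U S0 (f @: I)%SET].

(* The regular module R^o is what gives the function space its structure of
   R-vector space. *)
Notation vec R S := {ffun S -> R^o}.

Definition incidence (R : realType) (S : finType) (B : {set S}) : vec R S :=
  [ffun s => (s \in B)%:R].

Definition convex_hull (R : realType) (S : finType) (X : set (vec R S)) :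
    set (vec R S) :=
  [set x | exists (n : nat) (a : 'I_n -> R) (y : 'I_n -> vec R S),
     [/\ forall i, 0 <= a i, \sum_(i < n) a i = 1, forall i, X (y i) &
         x = \sum_(i < n) a i *: y i]]%classic.

Definition base_polytope (R : realType) (S : finType) (M : matroid S) :
    set (vec R S) :=
  convex_hull [set incidence R B | B in [set B | is_base M B]]%classic.
Arguments base_polytope R {S} M.

Definition integral_vec (R : realType) (S : finType) (x : vec R S) : Prop :=
  forall s : S, x s \is a Num.int.

Definition dilate (R : realType) (S : finType) (q : nat) (P : set (vec R S)) :
    set (vec R S) :=
  [set q%:R *: x | x in P]%classic.

Definition affinely_independent (R : realType) (S : finType) (t : nat)
    (x : 'I_t -> vec R S) : Prop :=
  forall c : 'I_t -> R,
    \sum_(i < t) c i = 0 -> \sum_(i < t) c i *: x i = 0 -> forall i, c i = 0.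

Definition integer_caratheodory (R : realType) (S : finType)
    (P : set (vec R S)) : Prop :=
  forall (q : nat) (w : vec R S),
    (0 < q)%N -> integral_vec w -> dilate q P w ->
    exists (t : nat) (x : 'I_t -> vec R S) (n : 'I_t -> nat),
      [/\ affinely_independent x,
          forall i, P (x i) /\ integral_vec (x i),
          (\sum_(i < t) n i)%N = q &
          w = \sum_(i < t) (n i)%:R *: x i].

(* Main.v *)
(** A set I is linked from U in (V, A) iff some permutation of V fixes or moves
    along an arc every vertex outside I and sends I into U: close up each path
    into a cycle.  Gluing this description of the first gammoid to its transpose
    for the second turns the common bases into permutations supported on a fixed
    bipartite graph, with s in the base iff a distinguished edge e_s is used.
    An integer point w of q(P1 ∩ P2) thus lifts to a nonnegative matrix with all
    row and column sums q and entry w_s at e_s.  Choose such a lift m of minimal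
    support.  It is integral, and no nonzero matrix with zero line sums that
    vanishes at all e_s is supported in the support of m.  Peel permutations s_i
    off m, each with the largest possible multiplicity n_i: every step creates a
    new zero, so the s_i are affinely independent.  A dependency between their
    restrictions to the edges e_s would give a matrix forbidden by the
    minimality of m, so these restrictions, which are incidence vectors of
    common bases, are affinely independent as well. *)
From mathcomp Require Import classical_sets reals boolp.
From mathcomp Require Import all_boot all_order all_algebra all_fingroup.
Require Import Defs.

Set Implicit Arguments.
Unset Strict Implicit.
Unset Printing Implicit Defensive.

Import Order.TTheory GRing.Theory Num.Theory.
Local Open Scope ring_scope.

(** * Matrices with zero line sums *)

(** A trivial left kernel would force [m = n] and [N] invertible, against [N *m v = 0] with [v]
    nonzero. *)
Lemma left_kernel_vector (F : fieldType) (m n : nat) (N : 'M[F]_(m, n))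
    (v : 'cV[F]_n) :
  (n <= m)%N -> v != 0 -> N *m v = 0 -> exists2 u : 'rV_m, u != 0 & u *m N = 0.
Proof.
move=> le_nm v_neq0 Nv0.
have: kermx N != 0.
  apply: contraNneq v_neq0 => kerN0.
  have freeN : \rank N = m.
    by apply/eqP; rewrite -[_ == _]/(row_free N) -kermx_eq0 kerN0.
  have mn : m = n by apply/eqP; rewrite eqn_leq le_nm andbT -freeN rank_leq_col.
  case: n / mn N v Nv0 freeN {le_nm kerN0} => N v Nv0 freeN.
  have uN : N \in unitmx by rewrite -row_free_unit /row_free freeN.
  by rewrite -(mulKmx uN v) Nv0 mulmx0.
by case/rowV0Pn => u /sub_kermxP uN u0; exists u.
Qed.

Section ZeroSums.
Variables (F : fieldType) (T : finType).

(* A bipartite graph in which every non-isolated vertex has degree at least 2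
   has at least as many edges as non-isolated vertices, while the incidence
   vectors of its edges all lie in the hyperplane "total weight of the rows
   equals total weight of the columns". *)
Lemma zero_sum_direction (E : {set T * T}) :
  E != set0 ->
  (forall e, e \in E -> exists2 j, j != e.2 & (e.1, j) \in E) ->
  (forall e, e \in E -> exists2 i, i != e.1 & (i, e.2) \in E) ->
  exists2 d : T -> T -> F, (exists i j, d i j != 0) &
    [/\ forall i, \sum_j d i j = 0, forall j, \sum_i d i j = 0 &
        forall i j, (i, j) \notin E -> d i j = 0].
Proof.
move=> /set0Pn[e0 Ee0] row2 col2.
pose inc (e : T * T) (x : T + T) :=
  match x with inl i => e.1 == i | inr j => e.2 == j end.
pose W := [set x | [exists e in E, inc e x]].
have incE e : e \in E -> (\sum_(x in W) inc e x = 2)%N.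
  move=> Ee.
  have W1 : inl e.1 \in W by rewrite inE; apply/exists_inP; exists e; rewrite /= ?eqxx.
  have W2 : inr e.2 \in W by rewrite inE; apply/exists_inP; exists e; rewrite /= ?eqxx.
  rewrite (bigD1 (inl e.1)) //= (bigD1 (inr e.2)) ?W2 //= /inc !eqxx big1 // => -[i|j].
    by case/andP=> /andP[_ +] _; rewrite -[_ == _]/(i == _) eq_sym => /negPf ->.
  by case/andP=> _; rewrite -[_ == _]/(j == _) eq_sym => /negPf ->.
have degW x : x \in W -> (2 <= \sum_(e in E) inc e x)%N.
  rewrite inE => /exists_inP[e Ee ex].
  have [e' e'e E'x] : exists2 e', e' != e & (e' \in E) && inc e' x.
    case: x ex => [i|j] /= /eqP <-.
      have [j je Ej] := row2 _ Ee; exists (e.1, j); rewrite ?Ej ?eqxx //.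
      by apply: contraNneq je => <-.
    have [i ie Ei] := col2 _ Ee; exists (i, e.2); rewrite ?Ei ?eqxx //.
    by apply: contraNneq ie => <-.
  case/andP: E'x => Ee' e'x.
  by rewrite (bigD1 e) //= (bigD1 e') /= ?Ee' // ex e'x.
have leWE : (#|W| <= #|E|)%N.
  rewrite -(leq_pmul2r (isT : (0 < 2)%N)) -!sum_nat_const.
  rewrite -(eq_bigr _ incE) exchange_big /=.
  by apply: leq_sum.
pose N : 'M[F]_(#|E|, #|W|) := \matrix_(a, b) (inc (enum_val a) (enum_val b))%:R.
(* The signs cancel on each edge, which joins one row to one column. *)
pose v : 'cV[F]_#|W| := \col_b (if enum_val b is inl _ then 1 else -1).
have W1 : inl e0.1 \in W by rewrite inE; apply/exists_inP; exists e0; rewrite /= ?eqxx.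
have v0 : v != 0.
  apply/eqP => /matrixP/(_ (enum_rank_in W1 (inl e0.1)) ord0).
  by rewrite !mxE enum_rankK_in //; apply/eqP/oner_neq0.
have Nv : N *m v = 0.
  apply/matrixP => a b; rewrite !mxE.
  pose e := enum_val a; have Ee : e \in E by apply: enum_valP.
  transitivity (\sum_(x in W) (inc e x)%:R * (if x is inl _ then 1 else -1) : F).
    rewrite [RHS]big_enum_val /=; apply: eq_bigr => c _; by rewrite !mxE.
  have W1' : inl e.1 \in W by rewrite inE; apply/exists_inP; exists e; rewrite /= ?eqxx.
  have W2' : inr e.2 \in W by rewrite inE; apply/exists_inP; exists e; rewrite /= ?eqxx.
  rewrite (bigD1 (inl e.1)) //= (bigD1 (inr e.2)) ?W2' //= /inc !eqxx !mul1r big1.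
    by rewrite addr0 subrr.
  case=> [i|j] /andP[/andP[_ +] +].
    by rewrite -[_ == _]/(i == _) eq_sym => /negPf -> _; rewrite mul0r.
  by move=> _; rewrite -[_ == _]/(j == _) eq_sym => /negPf ->; rewrite mul0r.
have [u u0 uN] := left_kernel_vector leWE v0 Nv.
pose d i j := if pick [pred a | enum_val a == (i, j)] is Some a then u 0 a else 0.
have dE a : d (enum_val a).1 (enum_val a).2 = u 0 a.
  rewrite /d; case: pickP => [b|/(_ a)] /=; rewrite -surjective_pairing.
    by move/eqP/enum_val_inj ->.
  by rewrite eqxx.
have d0 i j : (i, j) \notin E -> d i j = 0.
  move=> Eij; rewrite /d; case: pickP => //= a /eqP aij.
  by move: (enum_valP a); rewrite aij (negPf Eij).
have dW x : \sum_(e in E) d e.1 e.2 * (inc e x)%:R = 0.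
  have [Wx|Wx] := boolP (x \in W).
    have /matrixP/(_ 0 (enum_rank_in Wx x)) := uN; rewrite !mxE => uN0; rewrite -[RHS]uN0.
    rewrite [LHS]big_enum_val /=; apply: eq_bigr => a _.
    by rewrite dE mxE enum_rankK_in.
  apply: big1 => e Ee; case ex: (inc e x); last by rewrite mulr0.
  by case/negP: Wx; rewrite inE; apply/exists_inP; exists e.
have sumE (G : T -> T -> F) :
    \sum_(e in E) d e.1 e.2 * G e.1 e.2 = \sum_i \sum_j d i j * G i j.
  rewrite pair_big /= big_mkcond /=; apply: eq_bigr => e _.
  by case: ifPn => // Ee; rewrite d0 ?mul0r // -surjective_pairing.
exists d.
  have [a ua] : exists a, u 0 a != 0.
    apply/existsP; apply: contra_neqT u0 => /existsPn u0.
    by apply/rowP => a; rewrite mxE; apply/eqP; rewrite -[_ == _]negbK u0.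
  by exists (enum_val a).1, (enum_val a).2; rewrite dE.
split=> // [i|j].
  have := dW (inl i); rewrite /= (sumE (fun k _ => (k == i)%:R)).
  rewrite (bigD1 i) //= [X in _ + X]big1 ?addr0 => [|k /negPf ki].
    by under eq_bigr do rewrite eqxx mulr1.
  by apply: big1 => l _; rewrite ki mulr0.
have := dW (inr j); rewrite /= (sumE (fun _ k => (k == j)%:R)) exchange_big /=.
rewrite (bigD1 j) //= [X in _ + X]big1 ?addr0 => [|k /negPf ki].
  by under eq_bigr do rewrite eqxx mulr1.
by apply: big1 => l _; rewrite ki mulr0.
Qed.

End ZeroSums.

(** * Integral points and decompositions of transportation polytopes *)

Section Rounding.
Variables (R : archiRealFieldType) (T : finType).
Implicit Types (z d : T -> T -> R) (fixed : rel T).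

(** For nonnegative [z] this says that [z] is a vertex of the polytope of nonnegative matrices with
    its line sums and its values on the [fixed] cells. *)
Definition rigid fixed z :=
  forall d, (forall i, \sum_j d i j = 0) -> (forall j, \sum_i d i j = 0) ->
    (forall i j, z i j = 0 -> d i j = 0) ->
    (forall i j, fixed i j -> d i j = 0) -> forall i j, d i j = 0.

(** Failure of rigidity gives a nonzero direction [d], which has a negative entry because its row
    sums vanish. Moving along [d] until a first entry of [z] reaches 0 loses a cell of the
    support. *)
Lemma shrink_support fixed z :
  (forall i j, 0 <= z i j) -> ~ rigid fixed z ->
  exists2 z', (forall i j, 0 <= z' i j) &
    [/\ forall i, \sum_j z' i j = \sum_j z i j,
        forall j, \sum_i z' i j = \sum_i z i j,
        forall i j, fixed i j -> z' i j = z i j,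
        forall i j, z i j = 0 -> z' i j = 0 &
        exists i j, z i j != 0 /\ z' i j = 0].
Proof.
move=> z0 nrig.
have [d [dr dc dz df [i0 [j0 dneg]]]] : exists d, [/\ forall i, \sum_j d i j = 0,
    forall j, \sum_i d i j = 0, forall i j, z i j = 0 -> d i j = 0,
    forall i j, fixed i j -> d i j = 0 & exists i j, d i j < 0].
  apply: contrapT => nd; apply: nrig => d dr dc dz df i j.
  apply: contrapT => /eqP dij; apply: nd; exists d; split=> //.
  apply: contrapT => npos.
  have dge0 k l : 0 <= d k l.
    by rewrite leNgt; apply/negP => dkl; apply: npos; exists k, l.
  case/negP: dij; have /eqP := dr i; rewrite psumr_eq0 // => /allP/(_ j).
  by apply; rewrite mem_index_enum.
pose P (e : T * T) := d e.1 e.2 < 0.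
pose G (e : T * T) := z e.1 e.2 / - d e.1 e.2.
case: (@arg_minP _ _ _ (i0, j0) P G dneg) => -[i1 j1]; rewrite /P /= => d1 Gmin.
(* The ratio test: the longest step that keeps every entry nonnegative. *)
pose t := G (i1, j1).
have t0 : 0 <= t by rewrite /t /G divr_ge0 // oppr_ge0 ltW.
exists (fun i j => z i j + t * d i j) => [i j|].
  have [dij|dij] := ltrP (d i j) 0; last by rewrite addr_ge0 // mulr_ge0.
  have := Gmin (i, j) dij; rewrite -/t {1}/G /= ler_pdivlMr ?oppr_gt0 //.
  by rewrite mulrN lerNl -subr_ge0 opprK addrC.
split=> [i|j|i j fij|i j zij|].
- by rewrite big_split /= -mulr_sumr dr mulr0 addr0.
- by rewrite big_split /= -mulr_sumr dc mulr0 addr0.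
- by rewrite (df _ _ fij) mulr0 addr0.
- by rewrite (dz _ _ zij) mulr0 addr0 zij.
exists i1, j1; split.
  by apply: contraTneq d1 => /dz ->; rewrite ltxx.
by rewrite /t /G /= invrN mulrN mulNr mulfVK ?subrr // lt_eqF.
Qed.

Lemma rigid_refinement fixed z :
  (forall i j, 0 <= z i j) ->
  exists2 z', (forall i j, 0 <= z' i j) &
    [/\ forall i, \sum_j z' i j = \sum_j z i j,
        forall j, \sum_i z' i j = \sum_i z i j,
        forall i j, fixed i j -> z' i j = z i j,
        forall i j, z i j = 0 -> z' i j = 0 & rigid fixed z'].
Proof.
pose supp z := [set e : T * T | z e.1 e.2 != 0].
have [n] := ubnP #|supp z|; elim: n z => // n IHn z lezn z0.
have [rz|/(shrink_support z0)] := pselect (rigid fixed z); first by exists z.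
case=> z1 z10 [r1 c1 f1 s1 [i [j [zij z1ij]]]].
have lt1 : (#|supp z1| < #|supp z|)%N.
  apply: proper_card; apply/properP; split.
    by apply/subsetP => e; rewrite !inE; apply: contra => /eqP/s1 ->.
  by exists (i, j); rewrite !inE //= z1ij eqxx.
have [z2 z20 [r2 c2 f2 s2 rig2]] := IHn z1 (leq_trans lt1 lezn) z10.
exists z2 => //; split=> // [k|k|k l fkl|k l zkl].
- by rewrite r2.
- by rewrite c2.
- by rewrite f2 // f1.
- by rewrite s2 // s1.
Qed.

Lemma int_sum_partner (I : finType) (g : I -> R) (i : I) :
  \sum_j g j \is a Num.int -> g i \isn't a Num.int ->
  exists2 j, j != i & g j \isn't a Num.int.
Proof.
move=> gsum gi; apply: contrapT => nj; case/negP: gi.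
have -> : g i = \sum_j g j - \sum_(j | j != i) g j.
  by rewrite (bigD1 i) //= addrK.
rewrite rpredB // rpred_sum // => j ji; apply: contrapT => /negP gj.
by apply: nj; exists j.
Qed.

(** The non-integral cells avoid the zeros of [z] and the fixed cells, and none is alone in its row
    or column. A zero-sum direction supported on them would contradict rigidity. *)
Lemma rigid_int fixed z :
  (forall i, \sum_j z i j \is a Num.int) ->
  (forall j, \sum_i z i j \is a Num.int) ->
  (forall i j, fixed i j -> z i j \is a Num.int) ->
  rigid fixed z -> forall i j, z i j \is a Num.int.
Proof.
move=> zr zc zf rig i0 j0; apply: contrapT => /negP z00.
pose E := [set e : T * T | z e.1 e.2 \isn't a Num.int].
have E0 : E != set0 by apply/set0Pn; exists (i0, j0); rewrite inE.
case: (@zero_sum_direction R T E E0).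
- move=> e; rewrite inE => /(int_sum_partner (zr e.1))[j je zj].
  by exists j; rewrite ?inE.
- move=> e; rewrite inE => /(@int_sum_partner _ (z^~ e.2) _ (zc e.2))[j je zj].
  by exists j; rewrite ?inE.
move=> d [i [j /eqP dij]] [dr dc dE]; apply: dij.
apply: rig => // k l zkl; apply: dE; rewrite inE negbK /=; last exact: zf.
by rewrite zkl rpred0.
Qed.

Lemma rigid_rounding fixed z :
  (forall i j, 0 <= z i j) ->
  (forall i, \sum_j z i j \is a Num.int) ->
  (forall j, \sum_i z i j \is a Num.int) ->
  (forall i j, fixed i j -> z i j \is a Num.int) ->
  exists2 m : T -> T -> nat, rigid fixed (fun i j => (m i j)%:R) &
    [/\ forall i, (\sum_j m i j)%:R = \sum_j z i j,
        forall j, (\sum_i m i j)%:R = \sum_i z i j,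
        forall i j, fixed i j -> (m i j)%:R = z i j &
        forall i j, z i j = 0 -> m i j = 0%N].
Proof.
move=> z0 zr zc zf.
have [z' z'0 [r c f s rig]] := rigid_refinement fixed z0.
have z'int i j : z' i j \is a Num.int.
  apply: (rigid_int _ _ _ rig) => [k|k|k l fkl]; rewrite ?r ?c ?f //.
  exact: zf.
pose m i j := Num.truncn (z' i j).
have mE i j : (m i j)%:R = z' i j by rewrite truncnK // -intrEge0.
have mE' : (fun i j => (m i j)%:R) = z' by apply: funext => i; apply: funext.
exists m; rewrite ?mE' //; split=> [i|j|i j|i j zij].
- by rewrite natr_sum (eq_bigr (z' i)) // r.
- by rewrite natr_sum (eq_bigr (z'^~ j)) // c.
- by rewrite mE; apply: f.
- by apply/eqP; rewrite -(eqr_nat R) mE s.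
Qed.

(** Dividing by [q] gives line sums 1. Rounding with no cell fixed yields a 0-1 matrix with the same
    line sums and no new support, that is, a permutation matrix. *)
Lemma permutation_in_support (m : T -> T -> nat) (q : nat) :
  (0 < q)%N -> (forall i, \sum_j m i j = q)%N -> (forall j, \sum_i m i j = q)%N ->
  exists s : {perm T}, forall i, (0 < m i (s i))%N.
Proof.
move=> q0 mr mc; have qR : q%:R != 0 :> R by rewrite pnatr_eq0 -lt0n.
pose z i j : R := (m i j)%:R / q%:R.
have zr i : \sum_j z i j = 1 by rewrite -mulr_suml -natr_sum mr divff.
have zc j : \sum_i z i j = 1 by rewrite -mulr_suml -natr_sum mc divff.
have [||||p _ [pr pc _ ps]] := @rigid_rounding (fun _ _ => false) z.
- by move=> i j; rewrite divr_ge0.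
- by move=> i; rewrite zr.
- by move=> j; rewrite zc.
- by [].
have {}pr i : (\sum_j p i j = 1)%N by apply/eqP; rewrite -(eqr_nat R) pr zr.
have {}pc j : (\sum_i p i j = 1)%N by apply/eqP; rewrite -(eqr_nat R) pc zc.
have exj i : exists j, (0 < p i j)%N.
  apply/existsP; apply: contra_eqT (pr i) => /existsPn p0.
  by rewrite big1 // => j _; apply/eqP; rewrite -leqn0 leqNgt p0.
have [s sP] := choice exj.
have sinj : injective s.
  move=> i k sik; apply/eqP; apply: contra_eqT (pc (s i)) => ik.
  rewrite (bigD1 i) //= (bigD1 k) 1?eq_sym //= {2}sik.
  by move: (sP i) (sP k); case: (p i _) (p k _) => [|a] [|b] // _ _; rewrite addSn addnS.
exists (perm sinj) => i; rewrite permE lt0n; apply: contraTneq (sP i) => mi0.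
by rewrite ps // /z mi0 mul0r.
Qed.

(** Strong induction on [q], subtracting a permutation in the support as often as possible. The last
    clause is the affine independence of the permutation matrices. *)
Lemma birkhoff_decomposition (m : T -> T -> nat) (q : nat) :
  (forall i, \sum_j m i j = q)%N -> (forall j, \sum_i m i j = q)%N ->
  exists (t : nat) (s : 'I_t -> {perm T}) (n : 'I_t -> nat),
    [/\ forall a, (0 < n a)%N, (\sum_a n a = q)%N,
        forall i j, (m i j = \sum_a n a * (s a i == j))%N,
        forall a i, (0 < m i (s a i))%N &
        forall c : 'I_t -> R, \sum_a c a = 0 ->
          (forall i j, \sum_a c a * (s a i == j)%:R = 0) -> forall a, c a = 0].
Proof.
have [N] := ubnP q; elim: N q m => // N IHN q m leqN mr mc.
case: (posnP q) => [q0|q_gt0].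
  have m0 i j : m i j = 0%N.
    by apply/eqP; rewrite -leqn0 -q0 -(mr i) (bigD1 j) //= leq_addr.
  exists 0%N, (fun=> 1%g), (fun=> 0%N); split=> [[]||i j|[]|c _ _ []] //.
  - by rewrite big_ord0 q0.
  - by rewrite m0 big_ord0.
have [s0 s0P] := permutation_in_support q_gt0 mr mc.
(* Over an empty [T] all matrices coincide: the only permutation is taken [q] times, and
   [\sum_a c a = 0] settles independence. *)
have [i0 _|T0] := pickP [pred i : T | true]; last first.
  exists 1%N, (fun=> s0), (fun=> q).
  split=> [//||i j|//|c]; rewrite ?big_ord1 //; first by have := T0 i.
  by move=> c0 _ a; rewrite ord1.
case: (@arg_minnP _ i0 xpredT (fun i => m i (s0 i)) isT) => i1 _ min1.
pose t0 := m i1 (s0 i1); have t0_gt0 : (0 < t0)%N by apply: s0P.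
pose m' i j := (m i j - t0 * (s0 i == j))%N.
have le_m i j : (t0 * (s0 i == j) <= m i j)%N.
  by case: eqP => [<-|_]; rewrite ?muln1 ?muln0 // min1.
have m'r i : (\sum_j m' i j = q - t0)%N.
  rewrite sumnB // mr; congr (_ - _)%N.
  rewrite (bigD1 (s0 i)) //= eqxx muln1 big1 ?addn0 // => j.
  by rewrite eq_sym => /negPf ->; rewrite muln0.
have m'c j : (\sum_i m' i j = q - t0)%N.
  rewrite sumnB // mc; congr (_ - _)%N.
  rewrite (bigD1 ((s0^-1)%g j)) //= permKV eqxx muln1 big1 ?addn0 // => i.
  by rewrite (can2_eq (permK s0) (permKV s0)) => /negPf ->; rewrite muln0.
have le_t0q : (t0 <= q)%N by rewrite -(mr i1) (bigD1 (s0 i1)) //= leq_addr.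
have lt_q : (q - t0 < N)%N.
  by rewrite -ltnS (leq_trans _ leqN) // ltnS ltn_subrL t0_gt0.
have [t [s [n [n_gt0 nsum m'E s_supp s_ind]]]] := IHN _ _ lt_q m'r m'c.
pose fcons U (u0 : U) (u : 'I_t -> U) a := oapp u u0 (unlift ord0 a).
have fcons0 U (u0 : U) u : fcons U u0 u ord0 = u0 by rewrite /fcons unlift_none.
have fconsS U (u0 : U) u a : fcons U u0 u (lift ord0 a) = u a.
  by rewrite /fcons liftK.
exists t.+1, (fcons _ s0 s), (fcons _ t0 n); split.
- by move=> a; case: (unliftP ord0 a) => [b|] ->; rewrite ?fcons0 ?fconsS.
- rewrite big_ord_recl fcons0 (eq_bigr n) ?nsum ?subnKC //.
- move=> i j; rewrite big_ord_recl !fcons0.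
  under eq_bigr do rewrite !fconsS.
  by rewrite -m'E subnKC.
- move=> a i; case: (unliftP ord0 a) => [b|] ->; rewrite ?fcons0 ?fconsS //.
  by apply: leq_trans (s_supp b i) _; apply: leq_subr.
move=> c csum cmx.
(* The cell that realises the minimum is used by s0 and by no other s a. *)
have c0 : c ord0 = 0.
  have := cmx i1 (s0 i1); rewrite big_ord_recl fcons0 eqxx mulr1 big1 ?addr0 //.
  move=> a _; rewrite fconsS; case: eqP => [sa|]; last by rewrite mulr0.
  by have := s_supp a i1; rewrite sa /m' eqxx muln1 subnn.
have cS := s_ind (fun a => c (lift ord0 a)).
move=> a; case: (unliftP ord0 a) => [b|] -> //; apply: cS => [|i j].
  by move: csum; rewrite big_ord_recl c0 add0r.
have := cmx i j; rewrite big_ord_recl c0 mul0r add0r => {2}<-.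
by apply: eq_bigr => b' _; rewrite fconsS.
Qed.

End Rounding.

(** * Linkings as permutations *)

Section Linkings.
Variables (V : finType) (A : rel V) (U I : {set V}).

(* Closing up each path of a linking by an arc from its end to its start, and
   fixing the vertices off the paths, gives a permutation of V. *)
Lemma linking_permutation :
  linked_onto A U I ->
  exists s : {perm V}, (forall v, v \notin I -> s v = v \/ A v (s v)) /\
    (forall v, v \in I -> s v \in U).
Proof.
case=> I' [I'U cardI' [p [dip startI' endI disj]]].
pose l i := (p i).1 :: (p i).2.
have ul i : uniq (l i) by case/andP: (dip i).
have l_inj v i j : v \in l i -> v \in l j -> i = j.
  move=> vi vj; apply: contraTeq vi => ij.
  by have := disjointFl (disj _ _ ij) (x := v); rewrite !inE => ->.
(* [next] is cyclic, so the end of a path is sent to its start. *)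
pose s v := if [pick i | v \in l i] is Some i then next (l i) v else v.
have sE v i : v \in l i -> s v = next (l i) v.
  by rewrite /s; case: pickP => [j vj vi|/(_ i) ->//]; rewrite (l_inj _ _ _ vj vi).
have sl v i : (s v \in l i) = (v \in l i).
  rewrite /s; case: pickP => [j vj|//]; have [<-|ij] := eqVneq j i.
    by rewrite mem_next.
  apply/idP/idP => vi; case/eqP: ij.
    by apply: l_inj vi; rewrite mem_next.
  exact: l_inj vj vi.
have s_inj : injective s.
  move=> v v' svv'; case: (pickP (fun i => v \in l i)) => [i /= vi|v0].
    have v'i : v' \in l i by rewrite -sl -svv' sl.
    by move: svv'; rewrite (sE _ _ vi) (sE _ _ v'i) => /(can_inj (prev_next (ul i))).
  have v'0 i : (v' \in l i) = false by rewrite -sl -svv' sl; apply: v0.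
  move: svv'; rewrite /s; case: pickP => [i|_]; first by rewrite (v0 i).
  by case: pickP => // i; rewrite v'0.
have last_l i : path_end (p i) \in l i by rewrite mem_last.
have Iend v : v \in I -> exists i, v = path_end (p i).
  (* The ends are [#|I|] distinct vertices of [I], hence all of them. *)
  suff eqI : [set path_end (p i) | i in [set: _]] = I.
    by move=> vI; move: (vI); rewrite -{1}eqI => /imsetP[i _ ->]; exists i.
    apply/eqP; rewrite eqEcard card_in_imset ?cardsT ?card_ord ?leqnn ?andbT.
      by apply/subsetP => _ /imsetP[i _ ->].
    move=> i j _ _ eij; apply: (l_inj (path_end (p i))) => //.
    by rewrite eij.
exists (perm s_inj); split=> v; rewrite permE.
  move=> vI; case: (pickP (fun i => v \in l i)) => [i /= vi|v0]; last first.
    by left; rewrite /s; case: pickP => // i; rewrite (v0 i).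
  right; rewrite (sE _ _ vi) next_nth vi /l.
  have k_lt : (index v (l i) < size (p i).2)%N.
    rewrite ltn_neqAle -ltnS -[(size _).+1]/(size (l i)) index_mem vi andbT.
    apply: contraNneq vI => k_eq.
    by rewrite -(nth_index (p i).1 vi) k_eq nth_last; apply: endI.
  case/andP: (dip i) => /(pathP (p i).1)/(_ _ k_lt) + _.
  by rewrite -[_ :: _]/(l i) (nth_index _ vi).
case/Iend=> i ->; rewrite (sE _ _ (last_l i)) next_nth last_l /l.
(* Past the last vertex [nth] returns its default, the start of the path. *)
rewrite /path_end index_last ?nth_default //; last exact: ul.
by apply: (subsetP I'U); apply: startI'.
Qed.

(** From [s v] with [v] in [I], follow [s] until the first return to [I]. Injectivity makes these
    orbit segments disjoint and free of repetitions. *)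
Lemma linked_of_injection (s : V -> V) :
  injective s -> (forall v, v \notin I -> s v = v \/ A v (s v)) ->
  (forall v, v \in I -> s v \in U) -> linked_onto A U I.
Proof.
move=> s_inj sA sU.
have return_time (i : 'I_#|I|) : exists m,
    iter m s (s (enum_val i)) \in I /\
    forall k, (k < m)%N -> iter k s (s (enum_val i)) \notin I.
  have exm : exists m, iter m s (s (enum_val i)) \in I.
    (* The predecessor accounts for starting one step after the vertex of [I]. *)
    exists (fingraph.order s (enum_val i)).-1; rewrite -iterSr prednK ?fingraph.order_gt0 //.
    by rewrite iter_order ?enum_valP.
  case: (ex_minnP exm) => m mI min_m; exists m; split=> // k.
  by rewrite ltnNge; apply: contraNN; apply: min_m.
have [m mP] := choice return_time.
have iter_inj k : injective (iter k s) by elim: k => //= k IHk x y /s_inj/IHk.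
(* Cancel [a] steps. If [a < b], one more cancellation puts a vertex of [I] on the second segment
   before its first return. *)
have meet a b i j : (a <= b)%N -> (b <= m j)%N ->
    iter a s (s (enum_val i)) = iter b s (s (enum_val j)) -> a = b /\ i = j.
  move=> le_ab le_bm; rewrite -(subnKC le_ab) iterD => /iter_inj.
  case k_eq: (b - a)%N => [|k] /=; first by move/s_inj/enum_val_inj->; rewrite addn0.
  move/s_inj => vi; have /negP[] : iter k s (s (enum_val j)) \notin I.
    by apply: (mP j).2; rewrite (leq_trans _ le_bm) // -k_eq leq_subr.
  by rewrite -vi enum_valP.
exists (s @: I); split; last 2 first.
- by rewrite card_imset.
- pose p (i : 'I_#|I|) :=
    (s (enum_val i), traject s (s (s (enum_val i))) (m i)).
  have pE i : (p i).1 :: (p i).2 = traject s (s (enum_val i)) (m i).+1 by [].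
  have upath i : uniq ((p i).1 :: (p i).2).
    rewrite pE; apply/(uniqP (s (enum_val i))) => a b.
    rewrite !inE size_traject => am bm; rewrite !nth_traject // => eab.
    have [ab|/ltnW ba] := leqP a b.
      exact: (meet _ _ _ _ ab bm eab).1.
    by apply/esym; apply: (meet _ _ _ _ ba am (esym eab)).1.
  exists p; split=> [i|i|i|i j ij].
  + rewrite /is_dipath upath andbT; apply/(pathP (s (enum_val i))) => k.
    rewrite pE /= size_traject => km.
    rewrite -[_ :: _]/(traject s (s (enum_val i)) (m i).+1).
    rewrite (nth_traject s (leqW km)).
    rewrite (set_nth_default (s (s (enum_val i)))) ?size_traject //.
    rewrite (nth_traject s km) -(iterSr k s (s _)) /=.
    (* A fixed vertex off [I] would repeat along the segment, so each step is an arc. *)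
    have [fix_k|//] := sA _ ((mP i).2 _ km).
    have /eqP := (meet k k.+1 i i (leqnSn k) km (esym fix_k)).1.
    by rewrite eqn_leq ltnn andbF.
  + by rewrite imset_f ?enum_valP.
  + by rewrite /path_end /= last_traject; apply: (mP i).1.
  rewrite disjoint_subset; apply/subsetP => x; rewrite !inE -!in_cons !pE.
  case/trajectP => a am ->; apply/trajectP => -[b bm eab]; case/eqP: ij.
  have [ab|/ltnW ba] := leqP a b.
    exact: (meet _ _ _ _ ab bm eab).2.
  by apply/esym; apply: (meet _ _ _ _ ba am (esym eab)).2.
by apply/subsetP => _ /imsetP[v vI ->]; apply: sU.
Qed.

End Linkings.

(** By counting, the set where [h] is undefined and the complement of its image have equal size. Any
    bijection from the former onto the latter, which lies in [U], completes [h] to an injection of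
    the kind that yields a linking. *)
Lemma linked_of_partial_injection (V : finType) (A : rel V) (U : {set V})
    (h : V -> option V) :
  (forall v v' u, h v = Some u -> h v' = Some u -> v = v') ->
  (forall v u, h v = Some u -> u = v \/ A v u) ->
  (forall u, u \notin U -> exists v, h v = Some u) ->
  linked_onto A U [set v | h v == None].
Proof.
move=> h_inj hA hU; set I := [set v | _].
pose g v := odflt v (h v); pose B := g @: ~: I.
have gE v : v \notin I -> h v = Some (g v) by rewrite inE /g; case: (h v).
have hB v u : h v = Some u -> u \in B.
  by move=> hv; apply/imsetP; exists v; rewrite ?inE /g hv.
have cardB : #|~: B| = #|I|.
  apply/eqP; rewrite -(eqn_add2l #|B|) cardsC card_in_imset.
    by rewrite addnC cardsC.
  move=> v v'; rewrite !in_setC => /gE hv /gE hv' gvv'.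
  by apply: (h_inj _ _ (g v)); rewrite // gvv'.
pose s v := if h v is Some u then u else nth v (enum (~: B)) (index v (enum I)).
have s_idx v : v \in I -> (index v (enum I) < size (enum (~: B)))%N.
  by rewrite -cardE cardB cardE index_mem mem_enum.
have sI v : v \in I -> s v \in ~: B.
  move=> vI; move: (vI); rewrite inE /s => /eqP ->.
  by rewrite -mem_enum mem_nth // s_idx.
apply: (@linked_of_injection _ _ _ _ s) => [v v' svv'|v vI|v vI].
- have [vI|vI] := boolP (v \in I); have [v'I|v'I] := boolP (v' \in I).
  + move: svv'; rewrite {1 2}/s; move: (vI) (v'I); rewrite !inE => /eqP -> /eqP ->.
    rewrite (set_nth_default v) ?s_idx // => /eqP.
    rewrite nth_uniq ?enum_uniq ?s_idx // => /eqP idx_eq.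
    by apply: (@index_inj _ v (enum I)); rewrite ?mem_enum.
  + by have := sI _ vI; rewrite inE svv' /s (gE _ v'I) (hB _ _ (gE _ v'I)).
  + by have := sI _ v'I; rewrite inE -svv' /s (gE _ vI) (hB _ _ (gE _ vI)).
  move: svv'; rewrite /s (gE _ vI) (gE _ v'I) => gvv'.
  by apply: (h_inj _ _ (g v)); rewrite ?gE // gvv'.
- by rewrite /s (gE _ vI); apply: hA; apply: gE.
apply: contraTT (sI _ vI) => /hU[v' hv'].
by rewrite inE negbK (hB _ _ hv').
Qed.

(** * Base polytopes of gammoids *)

Section BasePolytope.
Variables (R : realType) (S : finType) (M : matroid S).

Lemma card_indep I : I \in indep M -> (#|I| <= rank M)%N.
Proof. exact: (@leq_bigmax_cond _ (fun I => I \in indep M) (fun I => #|I|)). Qed.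

Lemma card_base B : is_base M B -> #|B| = rank M.
Proof.
move=> /maxsetP[Bi Bmax]; apply/eqP; rewrite eqn_leq card_indep //.
have [|J Ji rankE] := @eq_bigmax_cond _ (mem (indep M)) (fun I : {set S} => #|I|).
  by apply/card_gt0P; exists B.
rewrite [rank M]rankE.
rewrite leqNgt; apply/negP => /(indep_augment Bi Ji)[e].
rewrite !inE => /andP[/negP eB _] /Bmax eBB; apply: eB.
by rewrite -eBB ?subsetUr // setU11.
Qed.

Lemma is_base_card B : B \in indep M -> #|B| = rank M -> is_base M B.
Proof.
move=> Bi cardB; apply/maxsetP; split=> // C Ci BC.
by apply/esym/eqP; rewrite eqEcard BC cardB card_indep.
Qed.

Lemma base_polytope_sum (x : {ffun S -> R^o}) :
  base_polytope R M x -> \sum_s x s = (rank M)%:R.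
Proof.
case=> n [a [y [_ a1 yB ->]]].
under eq_bigr do rewrite sum_ffunE.
rewrite exchange_big -[RHS]mul1r -{1}a1 mulr_suml /=; apply: eq_bigr => i _.
have [B BB <-] := yB i; rewrite -(card_base BB) -sum1_card natr_sum mulr_sumr.
rewrite [RHS]big_mkcond /=; apply: eq_bigr => s _; rewrite !ffunE.
by case: (s \in B); rewrite ?scaler0.
Qed.

Lemma base_polytope_incidence B :
  is_base M B -> base_polytope R M (incidence R B).
Proof.
move=> BB; exists 1%N, (fun=> 1), (fun=> incidence R B); split=> //.
- by rewrite big_ord1.
- by move=> _; exists B.
- by rewrite big_ord1 scale1r.
Qed.

(* For a base, the matrix is that of the permutation closing up its linking,
   with the rows of the base erased. *)
Lemma linking_matrix (V : finType) (A : rel V) (U : {set V}) (f : S -> V)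
    (x : {ffun S -> R^o}) :
  injective f -> (forall I, I \in indep M -> linked_onto A U (f @: I)) ->
  base_polytope R M x ->
  exists X : V -> V -> R,
    [/\ forall v u, 0 <= X v u,
        forall v u, X v u != 0 -> (u == v) || A v u,
        forall v, \sum_u X v u = 1 - \sum_(s | f s == v) x s,
        forall u, \sum_v X v u <= 1 &
        forall u, u \notin U -> \sum_v X v u = 1].
Proof.
move=> f_inj link [n [a [y [a0 a1 yB ->]]]].
have exBt i : exists Bt : {set S} * {perm V}, [/\ y i = incidence R Bt.1,
    forall v, v \notin f @: Bt.1 -> Bt.2 v = v \/ A v (Bt.2 v) &
    forall v, v \in f @: Bt.1 -> Bt.2 v \in U].
  have [B BB <-] := yB i; have /maxsetP[Bi _] := BB.
  by have [t [tA tU]] := linking_permutation (link _ Bi); exists (B, t).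
have [Bt BtP] := choice exBt.
pose B i := (Bt i).1; pose t i := (Bt i).2.
pose X v u : R := \sum_i a i * ((v \notin f @: B i) && (t i v == u))%:R.
have colX u : \sum_v X v u = \sum_i a i * ((t i)^-1%g u \notin f @: B i)%:R.
  rewrite exchange_big; apply: eq_bigr => i _; rewrite -mulr_sumr; congr (_ * _).
  rewrite (bigD1 ((t i)^-1%g u)) //= permKV eqxx andbT big1 ?addr0 // => v.
  by rewrite (can2_eq (permK _) (permKV _)) => /negPf ->; rewrite andbF.
exists X; split=> [v u|v u|v|u|u uU].
- by rewrite sumr_ge0 // => i _; rewrite mulr_ge0.
- apply: contraNT; rewrite negb_or => /andP[uv nA]; rewrite /X big1 // => i _.
  case: andP => [[vB /eqP tv]|_]; last by rewrite mulr0.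
  have [_ /(_ v vB) tA _] := BtP i; move: nA uv; rewrite -tv.
  by case: tA => [tvv|->//]; rewrite /t tvv eqxx.
- rewrite /X exchange_big -[in RHS]a1 /=.
  under [X in _ - X]eq_bigr do rewrite sum_ffunE.
  rewrite [X in _ = _ - X]exchange_big -sumrB /=; apply: eq_bigr => i _.
  rewrite -mulr_sumr; have [yE _ _] := BtP i.
  under [X in _ - X]eq_bigr do rewrite yE !ffunE -/(B i).
  rewrite -scaler_sumr -[X in _ = _ - X]/(a i * _) -[X in _ = X - _]mulr1 -mulrBr.
  congr (_ * _); rewrite (bigD1 (t i v)) //= eqxx andbT.
  rewrite [X in _ + X]big1 ?addr0 => [|u]; last first.
    by rewrite eq_sym => /negPf ->; rewrite andbF.
  have [/imsetP[s sB ->]|vB] := boolP (v \in f @: B i).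
    rewrite (bigD1 s) //= sB big1 ?addr0 ?subrr // => r /andP[/eqP/f_inj ->].
    by rewrite eqxx.
  rewrite big1 ?subr0 // => s /eqP fs; case sB: (s \in B i) => //.
  by case/negP: vB; rewrite -fs imset_f.
- by rewrite colX -[leRHS]a1 ler_sum // => i _; rewrite ler_piMr // lern1 leq_b1.
- rewrite colX -[RHS]a1; apply: eq_bigr => i _.
  have [_ _ tU] := BtP i; rewrite (contra (tU _)) ?mulr1 //.
  by rewrite permKV.
Qed.

End BasePolytope.

(** The product of the marginals divided by their common total. It will pair the column deficits of
    the two linking matrices. *)
Lemma coupling (R : realFieldType) (I J : finType) (g : I -> R) (h : J -> R) :
  (forall i, 0 <= g i) -> (forall j, 0 <= h j) -> \sum_i g i = \sum_j h j ->
  exists2 y : I -> J -> R, forall i j, 0 <= y i j &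
    [/\ forall i, \sum_j y i j = g i, forall j, \sum_i y i j = h j &
        forall i j, y i j != 0 -> g i != 0 /\ h j != 0].
Proof.
move=> g0 h0 gh; pose c := \sum_i g i.
have c0 : 0 <= c by apply: sumr_ge0.
(* If [c] is 0, then [c / c] is 0, but so is every [g i]. *)
have gc i : c / c * g i = g i.
  have [cz|cnz] := eqVneq c 0; last by rewrite divff ?mul1r.
  move/eqP: cz; rewrite psumr_eq0 // => /allP/(_ i) /=.
  by rewrite mem_index_enum => /(_ isT)/eqP ->; rewrite mulr0.
have hc j : c / c * h j = h j.
  have [cz|cnz] := eqVneq c 0; last by rewrite divff ?mul1r.
  move/eqP: cz; rewrite /c gh psumr_eq0 // => /allP/(_ j) /=.
  by rewrite mem_index_enum => /(_ isT)/eqP ->; rewrite mulr0.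
exists (fun i j => g i * h j / c) => [i j|].
  by rewrite divr_ge0 ?mulr_ge0.
split=> [i|j|i j].
- by rewrite -mulr_suml -mulr_sumr -gh -mulrA mulrC gc.
- by rewrite -mulr_suml -mulr_suml mulrAC hc.
- by rewrite !mulf_eq0 !negb_or => /andP[/andP[]].
Qed.

(** * Common bases of two gammoids as permutations *)

Section TwoGammoids.
Variables (S V1 V2 : finType) (A1 : rel V1) (A2 : rel V2).
Variables (U1 : {set V1}) (U2 : {set V2}) (f1 : S -> V1) (f2 : S -> V2).
Hypotheses (f1_inj : injective f1) (f2_inj : injective f2).

(* Read as the edges of a bipartite graph on two copies of V1 + V2.  The second
   digraph is transposed, so that the row of f1 s can be matched with the
   column of f2 s: this edge is used exactly when s is in the common base. *)
Definition joint_edge (a b : V1 + V2) : bool :=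
  match a, b with
  | inl v, inl u => (u == v) || A1 v u
  | inl v, inr v' => [exists s, (f1 s == v) && (f2 s == v')]
  | inr u', inl u => (u \in U1) && (u' \in U2)
  | inr u', inr v' => (u' == v') || A2 v' u'
  end.

Definition common_set (t : {perm V1 + V2}) : {set S} :=
  [set s | t (inl (f1 s)) == inr (f2 s)].

(** In the first block [t] is a partial injection, undefined exactly at the rows that leave through
    a distinguished edge; columns outside [U1] cannot be entered from the other block. *)
Lemma common_set_linked (t : {perm V1 + V2}) :
  (forall a, joint_edge a (t a)) ->
  linked_onto A1 U1 (f1 @: common_set t) /\
  linked_onto A2 U2 (f2 @: common_set t).
Proof.
move=> tE; split.
  pose h v := if t (inl v) is inl u then Some u else None.
  have hE v u : h v = Some u -> t (inl v) = inl u.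
    by rewrite /h; case: (t _) => // w [->].
  have -> : f1 @: common_set t = [set v | h v == None].
    apply/setP => v; rewrite inE /h; apply/imsetP/idP => [[s]|].
      by rewrite inE => /eqP + -> => ->.
    have := tE (inl v); case tv: (t _) => [//|v'] /= /existsP[s].
    case/andP=> /eqP fs1 /eqP fs2 _; exists s; rewrite // inE fs1 tv fs2.
    exact: eqxx.
  apply: linked_of_partial_injection => [v v' u /hE tv /hE tv'|v u /hE tv|u uU].
  - by have /perm_inj[] : t (inl v) = t (inl v') by rewrite tv tv'.
  - by have := tE (inl v); rewrite tv => /orP[/eqP|]; [left|right].
  have := tE ((t^-1)%g (inl u)); rewrite permKV.
  case tu: ((t^-1)%g (inl u)) => [v|u'] /=; last by rewrite (negPf uU).
  by exists v; rewrite /h -tu permKV.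
(* The second digraph is transposed, so [t^-1] follows its arcs forwards. *)
pose h v := if (t^-1)%g (inr v) is inr u then Some u else None.
have hE v u : h v = Some u -> t (inr u) = inr v.
  rewrite /h; case tv: ((t^-1)%g _) => [//|w] [<-].
  by rewrite -tv permKV.
have -> : f2 @: common_set t = [set v | h v == None].
  apply/setP => v; rewrite inE /h; apply/imsetP/idP => [[s]|].
    by rewrite inE => /eqP ts ->; rewrite -ts permK.
  have := tE ((t^-1)%g (inr v)); rewrite permKV.
  case tv: ((t^-1)%g _) => [w|//] /existsP[s] /andP[/eqP fs1 /eqP fs2] _.
  by exists s; rewrite // inE fs1 fs2 -tv permKV.
apply: linked_of_partial_injection => [v v' u /hE tv /hE|v u /hE tv|u uU].
- by rewrite tv => -[].
- by have := tE (inr u); rewrite tv => /orP[/eqP|]; [left|right].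
have := tE (inr u); case tu: (t _) => [w|v] /=; first by rewrite (negPf uU) andbF.
by exists v; rewrite /h -tu permK.
Qed.

(** The diagonal blocks are the linking matrix of [A1] and the transpose of that of [A2]. The values
    [x s] complete the rows of the first and the columns of the second. The other lines have
    deficits of equal total, the sum of [x], and vanishing off [U1] and [U2]; a coupling fills
    them. *)
Lemma joint_matrix (R : realType) (M1 M2 : matroid S) (x : {ffun S -> R^o}) :
  (forall I, I \in indep M1 -> linked_onto A1 U1 (f1 @: I)) ->
  (forall I, I \in indep M2 -> linked_onto A2 U2 (f2 @: I)) ->
  base_polytope R M1 x -> base_polytope R M2 x ->
  exists2 z : V1 + V2 -> V1 + V2 -> R, forall a b, 0 <= z a b &
    [/\ forall a, \sum_b z a b = 1, forall b, \sum_a z a b = 1,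
        forall s, z (inl (f1 s)) (inr (f2 s)) = x s &
        forall a b, ~~ joint_edge a b -> z a b = 0].
Proof.
move=> link1 link2 x1 x2.
have [X1 [X1_ge0 X1A X1row X1col X1U]] := linking_matrix f1_inj link1 x1.
have [X2 [X2_ge0 X2A X2row X2col X2U]] := linking_matrix f2_inj link2 x2.
have x_ge0 s : 0 <= x s.
  have [n [a [y [a0 _ yB ->]]]] := x1.
  rewrite sum_ffunE sumr_ge0 // => i _; have [B _ <-] := yB i.
  by rewrite !ffunE mulr_ge0.
pose g u := 1 - \sum_v X1 v u; pose h u := 1 - \sum_v X2 v u.
have total (V : finType) (f : S -> V) (X : V -> V -> R) :
    (forall v, \sum_u X v u = 1 - \sum_(s | f s == v) x s) ->
    \sum_u (1 - \sum_v X v u) = \sum_s x s.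
  move=> Xrow; rewrite sumrB exchange_big /= (eq_bigr _ (fun v _ => Xrow v)).
  by rewrite sumrB opprB addrC subrK [RHS](partition_big f xpredT).
have g_ge0 u : 0 <= g u by rewrite subr_ge0.
have h_ge0 u : 0 <= h u by rewrite subr_ge0.
have gh : \sum_u g u = \sum_u h u.
  by rewrite (total _ f1 _ X1row) (total _ f2 _ X2row).
have [y y_ge0 [ysum1 ysum2 y_supp]] := coupling g_ge0 h_ge0 gh.
pose z (a b : V1 + V2) : R :=
  match a, b with
  | inl v, inl u => X1 v u
  | inl v, inr v' => \sum_(s | (f1 s == v) && (f2 s == v')) x s
  | inr u', inl u => y u u'
  | inr u', inr v' => X2 v' u'
  end.
exists z => [[v|u'] [u|v'] //=|]; first by rewrite sumr_ge0.
split.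
- case=> [v|u']; rewrite big_sumType /=; last by rewrite ysum2 subrK.
  by rewrite X1row -(partition_big f2 xpredT) ?subrK.
- case=> [u|v']; rewrite big_sumType /=; first by rewrite ysum1 addrC subrK.
  rewrite X2row (eq_bigr (fun v => \sum_(s | (f2 s == v') && (f1 s == v)) x s)).
    by rewrite -(partition_big f1 xpredT) // addrC subrK.
  by move=> v _; apply: eq_bigl => s; rewrite andbC.
- move=> s; rewrite /= (bigD1 s) ?eqxx //= big1 ?addr0 // => r.
  by case/andP=> /andP[/eqP/f1_inj -> _] /eqP.
case=> [v|u'] [u|v'] /=.
- by apply: contraNeq; apply: X1A.
- move/existsPn=> ns; rewrite big1 // => s ss.
  by have := ns s; rewrite ss.
- apply: contraNeq => /y_supp[gu hu']; apply/andP; split.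
    by apply: contraNT gu => /X1U; rewrite /g => ->; rewrite subrr.
  by apply: contraNT hu' => /X2U; rewrite /h => ->; rewrite subrr.
by apply: contraNeq; apply: X2A.
Qed.

End TwoGammoids.

(** * The Integer Carathéodory Property of the intersection *)

Theorem theorem11 (R : realType) (S : finType) (M1 M2 : matroid S) (k : nat) :
  is_gammoid M1 -> is_gammoid M2 -> rank M1 = k -> rank M2 = k ->
  integer_caratheodory
    (base_polytope R M1 `&` base_polytope R M2)%classic.
Proof.
move=> [V1 [A1 [U1 [_ [f1 [f1_inj <- indep1]]]]]].
move=> [V2 [A2 [U2 [_ [f2 [f2_inj <- indep2]]]]]] rank1 rank2.
move=> q w q_gt0 w_int [x [x1 x2] wE].
have wsE s : w s = q%:R * x s by rewrite -wE ffunE.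
have link1 I : I \in indep M1 -> linked_onto A1 U1 (f1 @: I).
  by move/indep1 => [].
have link2 I : I \in indep M2 -> linked_onto A2 U2 (f2 @: I).
  by move/indep2 => [].
have [z z_ge0 [zrow zcol zx zE]] := joint_matrix f1_inj f2_inj link1 link2 x1 x2.
pose fixed (a b : V1 + V2) := [exists s, (a == inl (f1 s)) && (b == inr (f2 s))].
have [||||m m_rig [mrow mcol mw mE]] :=
  @rigid_rounding R _ fixed (fun a b => q%:R * z a b).
- by move=> a b; rewrite mulr_ge0.
- by move=> a; rewrite -mulr_sumr zrow mulr1.
- by move=> b; rewrite -mulr_sumr zcol mulr1.
- by move=> a b /existsP[s /andP[/eqP -> /eqP ->]]; rewrite zx -wsE.
have {}mrow a : (\sum_b m a b = q)%N.
  by apply/eqP; rewrite -(eqr_nat R) mrow -mulr_sumr zrow mulr1.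
have {}mcol b : (\sum_a m a b = q)%N.
  by apply/eqP; rewrite -(eqr_nat R) mcol -mulr_sumr zcol mulr1.
have {}mw s : (m (inl (f1 s)) (inr (f2 s)))%:R = w s.
  by rewrite mw ?zx ?wsE //; apply/existsP; exists s; rewrite !eqxx.
have {}mE a b : (0 < m a b)%N -> joint_edge A1 A2 U1 U2 f1 f2 a b.
  by apply: contraTT => /zE zab; rewrite mE // zab mulr0.
have [t [s [n [n_gt0 nsum mdec s_supp s_ind]]]] :=
  birkhoff_decomposition R mrow mcol.
pose B i := common_set f1 f2 (s i).
have linked i := common_set_linked (fun a => mE _ _ (s_supp i a)).
have B1 i : B i \in indep M1.
  by apply/indep1; split; [apply/imsetS/subsetT|case: (linked i)].
have B2 i : B i \in indep M2.
  by apply/indep2; split; [apply/imsetS/subsetT|case: (linked i)].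
have wB r : w r = \sum_i (n i)%:R * incidence R (B i) r.
  by rewrite -mw mdec natr_sum; apply: eq_bigr => i _; rewrite natrM !ffunE inE.
have leB i : (#|B i| <= k)%N by rewrite -rank1 card_indep.
(* The entries of [w] sum to [q * k]. As no [B i] has more than [k] elements and every [n i] is
   positive, all have exactly [k]. *)
have sumB : (\sum_i n i * #|B i| = \sum_i n i * k)%N.
  apply/eqP; rewrite -big_distrl /= nsum -(eqr_nat R) natrM -rank1.
  rewrite -(base_polytope_sum x1) mulr_sumr natr_sum.
  under [eqbRHS]eq_bigr do rewrite -wsE wB.
  rewrite exchange_big /=; apply/eqP/eq_bigr => i _.
  rewrite natrM -mulr_sumr; congr (_ * _).
  rewrite -sum1_card natr_sum big_mkcond /=; apply: eq_bigr => r _.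
  by rewrite ffunE; case: (r \in B i).
have cardB i : #|B i| = k.
  have le i' : true -> (n i' * #|B i'| <= n i' * k)%N by rewrite leq_mul2l leB orbT.
  have := leqif_sum (fun i' (_ : true) => leqif_eq (le i' isT)).
  case=> _; rewrite sumB eqxx => /esym/forall_inP/(_ i isT).
  by rewrite eqn_pmul2l // => /eqP.
exists t, (fun i => incidence R (B i)), n; split=> //.
- move=> c c0 cB; apply: s_ind => //.
  (* A dependency among the incidence vectors gives a combination of permutation matrices that is
     supported in [m] and zero on the [fixed] cells; rigidity makes it vanish. *)
  apply: (m_rig (fun a b => \sum_i c i * (s i a == b)%:R)).
  + move=> a; rewrite exchange_big -[RHS]c0; apply: eq_bigr => i _.
    rewrite -mulr_sumr (bigD1 (s i a)) //= eqxx big1 ?addr0 ?mulr1 // => b.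
    by rewrite eq_sym => /negPf ->.
  + move=> b; rewrite exchange_big -[RHS]c0; apply: eq_bigr => i _.
    rewrite -mulr_sumr (bigD1 ((s i)^-1%g b)) //= permKV eqxx big1 ?addr0 ?mulr1 //.
    by move=> a; rewrite (can2_eq (permK _) (permKV _)) => /negPf ->.
  + move=> a b mab; apply: big1 => i _; case: eqP => [sab|]; last by rewrite mulr0.
    by have := s_supp i a; rewrite sab lt0n -(eqr_nat R) mab eqxx.
  move=> a b /existsP[r /andP[/eqP -> /eqP ->]].
  have := congr1 (fun y : {ffun S -> R^o} => y r) cB; rewrite sum_ffunE !ffunE => cBr; rewrite -[RHS]cBr.
  by apply: eq_bigr => i _; rewrite !ffunE inE.
- move=> i; split; last by move=> r; rewrite ffunE rpred_nat.
  by split; apply/base_polytope_incidence/is_base_card; rewrite ?rank1 ?rank2.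
apply/ffunP => r; rewrite wB sum_ffunE; apply: eq_bigr => i _.
by rewrite [RHS]ffunE.
Qed.
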